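(* Let $\varphi\in SE$ with $\eta$-index $\rho$ and let $h:\mathbb{R}\to\mathbb{R}$. Suppose that the pointwise convergence $$h(x+t\varphi(x))-h(x)\to K(t)\in\mathbb{R}\qquad(x\to\infty)$$ holds for all $t$ in a co-meagre subset of $\mathbb{G}_+^\rho=(\rho^*,\infty)$, that the limit function $K$ is upper semicontinuous also on a co-meagre set, and that the one-sided condition $$K(t)=\lim_{\delta\downarrow 0}\limsup_{x\to\infty}\,\sup\{h(x+s\varphi(x))-h(x): s\in[t,t+\delta)\}$$ holds at the origin $t=0$. Then two-sided uniform convergence holds everywhere: $$\mathbb{A}^\varphi=\mathbb{A}_{\mathrm u}=\mathbb{G}_+^\rho .$$
   Context: A function $\varphi:(0,\infty)\to(0,\infty)$ is self-equivarying, written $\varphi\in SE$, if $\varphi(x)=O(x)$ as $x\to\infty$ and there is a function $\eta=\eta^\varphi:[0,\infty)\to(0,\infty)$ such that $\varphi(x+t\varphi(x))/\varphi(x)\to\eta(t)$ as $x\to\infty$, locally uniformly in $t\in[0,\infty)$. It is known that then $\eta(t)=1+\rho t$ for some $\rho\ge 0$, called the $\eta$-index $\rho_\varphi$ of $\varphi$. Put $\rho^*:=-1/\rho$ if $\rho>0$ and $\rho^*:=-\infty$ if $\rho=0$. $\mathbb{A}^\varphi$ is the set of $t>\rho^*$ for which $\lim_{x\to\infty}[h(x+t\varphi(x))-h(x)]$ exists and is finite, and $K(t)$ denotes this limit for $t\in\mathbb{A}^\varphi$ (so $K(0)=0$). $\mathbb{A}_{\mathrm u}$ is the set of those $t\in\mathbb{A}^\varphi$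 at which the convergence is uniform near $t$, i.e. for every $\varepsilon>0$ there are $\delta>0$ and $X$ such that $|h(x+s\varphi(x))-h(x)-K(t)|<\varepsilon$ for all $x>X$ and all $s\in(t-\delta,t+\delta)$.
   Formalization: When ρ = 0 it is additionally assumed that φ(x) = o(x) as x → ∞ (as in the usual definition of self-neglecting functions); without this the claim fails for some discontinuous φ in SE, at negative t. *)

(* Defs.v *)
From HB Require Import structures.
From mathcomp Require Import all_boot all_order all_algebra.
From mathcomp Require Import all_classical all_reals all_analysis.

Set Implicit Arguments.
Unset Strict Implicit.
Unset Printing Implicit Defensive.

Import Order.TTheory GRing.Theory Num.Theory.
Import numFieldNormedType.Exports.

Local Open Scope classical_set_scope.
Local Open Scope ring_scope.

Definition nowhere_dense (T : topologicalType) (A : set T) : Prop :=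
  (closure A)° = set0.

Definition meagre (T : topologicalType) (A : set T) : Prop :=
  exists F : nat -> set T,
    (forall n, nowhere_dense (F n)) /\ A `<=` \bigcup_n F n.

(* This is used for open G only; then being meagre in the subspace G and being
   meagre in T are the same thing for subsets of G. *)
Definition comeagre_in (T : topologicalType) (G S : set T) : Prop :=
  S `<=` G /\ meagre (G `\` S).

(* A function (0,oo) -> (0,oo) is encoded as a total function R -> R that is
   positive on (0,oo); its values elsewhere are irrelevant. Likewise only the
   restriction of eta to [0,oo) matters. The uniformity is over t >= 0 only, so
   for eta = 1 the condition phi(x) = O(x) does not force phi(x) = o(x): this
   last condition, part of the usual definition of self-neglecting functions,
   has to be required separately. *)
Definition self_equivarying (R : realType) (phi eta : R -> R) : Prop :=
  [/\ forall x : R, 0 < x -> 0 < phi x,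
      exists2 k : R, 0 < k & \forall x \near +oo, phi x <= k * x,
      forall t : R, 0 <= t -> 0 < eta t
    & forall t0 : R, 0 <= t0 -> exists2 U : set R, nbhs t0 U &
        {uniform U `&` [set t : R | 0 <= t],
          (fun x t : R => phi (x + t * phi x) / phi x) @ +oo --> eta}].

Definition rho_star (R : realType) (rho : R) : \bar R :=
  if 0 < rho then (- rho^-1)%:E else -oo%E.

Definition Gplus (R : realType) (rho : R) : set R :=
  [set t | (rho_star rho < t%:E)%E].

Definition increment (R : realType) (phi h : R -> R) (t x : R) : R :=
  h (x + t * phi x) - h x.

Definition Aphi (R : realType) (phi h : R -> R) (rho : R) : set R :=
  [set t | Gplus rho t /\ cvg (increment phi h t x @[x --> +oo])].

(* Meaningful only for t in [Aphi phi h rho]. *)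
Definition Klim (R : realType) (phi h : R -> R) (t : R) : R :=
  lim (increment phi h t x @[x --> +oo]).

Definition Au (R : realType) (phi h : R -> R) (rho : R) : set R :=
  [set t | Aphi phi h rho t /\
    forall eps : R, 0 < eps -> exists delta X : R, 0 < delta /\
      forall x s : R, X < x -> t - delta < s < t + delta ->
        `|increment phi h s x - Klim phi h t| < eps].

(* Upper semicontinuity of the restriction of f to S. *)
Definition usc_on (R : realType) (S : set R) (f : R -> R) : Prop :=
  forall t, S t -> forall eps : R, 0 < eps ->
    \forall s \near t, S s -> f s < f t + eps.

(* The supremum is taken in the extended reals: it may be +oo. *)
Definition one_sided_at (R : realType) (phi h : R -> R) (t : R) : Prop :=
  limf_esup
    (fun x => ereal_sup
       [set (increment phi h s x)%:E | s in [set s | t <= s < t + delta]])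
    (pinfty_nbhs R) @[delta --> 0^'+] --> (Klim phi h t)%:E.

(* Main.v *)
Require Import Defs.
From HB Require Import structures.
From mathcomp Require Import all_boot all_order all_algebra.
From mathcomp Require Import all_classical all_reals all_analysis.
From mathcomp Require Import ring lra.
Import Order.TTheory GRing.Theory Num.Theory.
Import numFieldNormedType.Exports.
Local Open Scope classical_set_scope.
Local Open Scope ring_scope.

(** Write y = x + t phi(x). Increments satisfy a cocycle identity: a step of
    size t' from x is a step of size t, followed by a step from y of size
    (t' - t) phi(x) / phi(y) ([increment_cocycle]). Since phi is
    self-equivarying, for t >= 0 the ratio phi(y) / phi(x) is close to
    1 + rho t. For t < 0 nothing of the kind holds in general, because phi may
    be discontinuous: phi(y) can be much smaller than phi(x). Nearby
    increments are therefore only compared through forward steps.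

    Baire's theorem replaces all regularity of h. Sort the t of good
    convergence into countably many classes, according to a threshold beyond
    which the increment is within e of its limit and to the approximate value
    of that limit. One class is dense in some subinterval of any given
    interval, and so the increments are nearly constant on a dense part of a
    cell, beyond one common threshold ([baire_cell]).

    Inside (0,1) the one-sided condition, applied between t and points of the
    dense class just to its left and just to its right, bounds the
    increment at every t of the cell from both sides ([forward_cell]). Both a
    step from x and a step from x + s phi(x) of sizes near the middle of the
    cell lead to a same point, with nearly the same increment; hence short
    forward increments are small in absolute value, and the one-sided condition
    at the origin becomes two-sided ([small_increment]).

    With this, a dense class lying just to the right of t controls the
    increment at t, for t of either sign; here y tends to infinity with x, as
    phi(x) <= (rho + o(1)) x ([ratio_le], [near_shift]). Hence every interval of
    the half-line contains a cell on which the increments are uniformly nearly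
    constant ([uniform_cell]). Finally any t0 is reached from a cell to its
    left: a first forward step, of fixed size s where the increments converge,
    carries the cell onto a neighbourhood of t0 ([locally_uniform]). The
    resulting Cauchy condition, uniform near t0, is the theorem. *)

Set Implicit Arguments.
Unset Strict Implicit.

(** * Baire category on a half-line *)

Lemma Gplus_gt0 (R : realType) (rho t : R) :
  0 <= rho -> Gplus rho t <-> 0 < 1 + rho * t.
Proof.
rewrite le_eqVlt => /predU1P[<-|rho_gt0]; rewrite /Gplus /rho_star /=.
  by rewrite ltxx mul0r addr0 ltr01 ltNyr.
rewrite rho_gt0 lte_fin ltrNl -[X in _ < X]mul1r ltr_pdivlMr // mulNr.
by split=> ?; lra.
Qed.

Lemma nowhere_dense_dense (T : topologicalType) (A : set T) :
  nowhere_dense A -> dense (~` closure A).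
Proof.
move=> A0 O [z Oz] Oopen; apply: contrapT => O_A.
suff : (closure A)° z by rewrite A0.
apply/(filterS _ (open_nbhs_nbhs (conj Oopen Oz))) => y Oy.
by apply: contrapT => Ay; apply: O_A; exists y.
Qed.

(** Were every [E n] nowhere dense in the interval, then the interval would be a
    countable union of nowhere dense sets, those of the meagre complement of
    [S] included, against Baire's theorem. The [E n] are arbitrary sets, so that
    they may be defined from a function without any regularity. *)
Lemma comeagre_cover_dense (R : realType) (G S : set R) (E : nat -> set R)
    (a b : R) :
  comeagre_in G S -> a < b -> `]a, b[ `<=` G ->
  S `&` `]a, b[ `<=` \bigcup_n E n ->
  exists n a' b', [/\ a <= a', a' < b', b' <= b &
    forall u v, a' <= u -> u < v -> v <= b' -> exists2 t, u < t < v & E n t].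
Proof.
move=> [_ [F [F_nd F_cover]]] ab abG SE; pose D n := E n `&` `]a, b[.
have [D_nd|] := pselect (forall n, nowhere_dense (D n)).
  have U_od n : open (~` closure (F n) `&` ~` closure (D n)) /\
      dense (~` closure (F n) `&` ~` closure (D n)).
    have Fn_open : open (~` closure (F n)) by exact/closed_openC/closed_closure.
    split; first by apply: openI => //; exact/closed_openC/closed_closure.
    by apply: denseI => //; exact: nowhere_dense_dense.
  have ab0 : [set` `]a, b[] !=set0.
    by exists ((a + b) / 2); rewrite /= in_itv /=; apply/andP; split; lra.
  have ab_open : open [set` `]a, b[] by exact: interval_open.
  have [t [abt out]] := Baire U_od ab0 ab_open.
  have [St|nSt] := pselect (S t).
    have [n _ Ent] := SE _ (conj St abt).
    by have [_] := out n I; case; apply: subset_closure.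
  have [n _ Fnt] := F_cover t (conj (abG _ abt) nSt).
  by have [+ _] := out n I; case; apply: subset_closure.
move=> /existsNP[n /eqP/set0P[z Dz]].
have [w [[Ew +] wD]] := interior_subset Dz _
  (open_nbhs_nbhs (conj (@open_interior _ _) Dz)).
rewrite /= in_itv /= => /andP[aw wb].
have /nbhs_ballP[r /= r0 wr] : nbhs w (closure (D n)) by exact: wD.
exists n, (Num.max a (w - r)), (Num.min b (w + r)).
split; first by rewrite le_max lexx.
- by rewrite gt_max !lt_min; apply/andP; split; apply/andP; split; lra.
- by rewrite ge_min lexx.
move=> u v; rewrite ge_max le_min => /andP[au wu] uv /andP[vb vw].
have : closure (D n) ((u + v) / 2).
  by apply: wr; rewrite /ball /= ltr_norml; apply/andP; split; lra.
move=> /(_ [set` `]u, v[]) []; first apply: open_nbhs_nbhs; first split.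
- exact: interval_open.
- by rewrite /= in_itv /=; apply/andP; split; lra.
by move=> t [[Et _]]; rewrite /= in_itv /= => uvt; exists t.
Qed.

(** * Self-equivarying functions *)

(** Local uniformity on the half-line becomes uniformity on [0,T] by
    compactness. *)
Lemma equivarying_near (R : realType) (phi eta : R -> R) (rho T e : R) :
  self_equivarying phi eta -> (forall t, 0 <= t -> eta t = 1 + rho * t) ->
  0 < e -> \forall x \near +oo, forall t, 0 <= t <= T ->
    `|phi (x + t * phi x) / phi x - (1 + rho * t)| < e.
Proof.
move=> [_ _ _ unif] eta_rho e0.
have /compact_near_coveringP cov := @segment_compact R 0 T.
suff /cov : forall t0 : R, [set` `[0, T]] t0 ->
    \forall t \near t0 & x \near +oo, 0 <= t ->
      `|phi (x + t * phi x) / phi x - (1 + rho * t)| < e.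
  apply: filterS => x Hx t /andP[t0 tT].
  by apply: (Hx t) => //; rewrite /= in_itv /= t0.
move=> t0; rewrite /= in_itv /= => /andP[t0_ge0 _].
have [U Ut0 Ucvg] := unif _ t0_ge0.
exists (U, [set x | forall t, (U `&` [set t | 0 <= t]) t ->
    `|eta t - phi (x + t * phi x) / phi x| < e]) => /=.
  split => //; apply: (Ucvg [set f : {uniform` _ -> R} |
    forall t, (U `&` [set t | 0 <= t]) t -> `|eta t - f t| < e]).
  apply/uniform_nbhs.
  exists [set xy : R * R | `|xy.1 - xy.2| < e]; split => //.
  exact: (@entourage_ball _ R (PosNum e0)).
by move=> [t x] /= [Ut Hx] tge0; rewrite distrC -eta_rho //; exact: Hx.
Qed.

(** Along the orbit x, x + phi(x), ... each step of length phi(x) raises phi by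
    at most (rho + e1) phi(x), so that phi stays below a line of slope rho + e1.
    The orbit exhausts the half-line since phi does not decrease along it; this
    is where rho > 0 matters, for an orbit can accumulate at a finite point when
    rho = 0. Between two points of the orbit, uniformity on [0,1] and the
    bound phi(x) <= k x cost no more than a further e1 k x. *)
Lemma ratio_le (R : realType) (phi eta : R -> R) (rho e : R) :
  self_equivarying phi eta -> (forall t, 0 <= t -> eta t = 1 + rho * t) ->
  0 < rho -> 0 < e -> \forall x \near +oo, phi x <= (rho + e) * x.
Proof.
move=> SE eta_rho rho0 e0; have [phi_gt0 [k k0 phi_k] _ _] := SE.
pose e1 := Num.min rho (Num.min (e / 4) (e / (4 * k))).
have e1_gt0 : 0 < e1 by rewrite !lt_min rho0 !divr_gt0 ?mulr_gt0.
have e1_rho : e1 <= rho by rewrite ge_min lexx.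
have e1_le : e1 <= e / 4 by rewrite !ge_min lexx orbT.
have e1k : e1 * k <= e / 4.
  have : e1 <= e / (4 * k) by rewrite !ge_min lexx !orbT.
  by rewrite ler_pdivlMr ?mulr_gt0//; lra.
have [X [_ HX]] : \forall x \near +oo, [/\ 0 < x, phi x <= k * x &
    forall t, 0 <= t <= 1 ->
      `|phi (x + t * phi x) / phi x - (1 + rho * t)| < e1].
  near=> x; split; near: x => //; last exact: equivarying_near SE eta_rho _.
  exact: nbhs_pinfty_gt.
have {}HX x : X < x -> [/\ 0 < x, 0 < phi x, phi x <= k * x &
    forall t, 0 <= t <= 1 -> (1 + rho * t - e1) * phi x < phi (x + t * phi x)
      < (1 + rho * t + e1) * phi x].
  move=> /HX[x0 xk xt]; have px := phi_gt0 _ x0; split => // t /xt.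
  by rewrite ltr_distl ltr_pdivrMr // ltr_pdivlMr.
pose x0 := X + 1; pose C := phi x0.
have [x0_gt0 C_gt0 _ _] : [/\ 0 < x0, 0 < C, phi x0 <= k * x0 & _] :=
  HX x0 ltac:(rewrite /x0; lra).
(* the points of an orbit started at x0 stay in B *)
pose B x := [/\ x0 <= x, C <= phi x & phi x <= C + (rho + e1) * (x - x0)].
have Bnext x : B x -> B (x + phi x).
  move=> [x0x Cx xC].
  have [_ px _ /(_ 1)] := HX x ltac:(rewrite /x0 in x0x; lra).
  rewrite mul1r mulr1 ler01 lexx => /(_ isT)/andP[lo hi].
  split; [lra| |].
    have : 0 <= (rho - e1) * phi x by rewrite mulr_ge0 ?subr_ge0 // ltW.
    lra.
  lra.
have Breach n : forall x z, B x -> x <= z -> z < x + C *+ n ->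
    exists2 y, B y & y <= z < y + phi y.
  elim: n => [|n IHn] x z Bx xz; first by rewrite mulr0n addr0 ltNge xz.
  move=> zx; have [zlt|zge] := ltP z (x + phi x).
    by exists x; rewrite ?xz.
  apply: (IHn (x + phi x)) => //; first exact: Bnext.
  by have [_ Cx _] := Bx; rewrite mulrS in zx; lra.
near=> z.
have z_x0 : x0 <= z by near: z; exact/nbhs_pinfty_ge/num_real.
have z_C : 2 * C / e <= z by near: z; exact/nbhs_pinfty_ge/num_real.
have [y [x0y Cy yC] /andP[yz zy]] : exists2 y, B y & y <= z < y + phi y.
  apply: (Breach (Num.bound ((z - x0) / C)) x0) => //.
    by split; rewrite // subrr mulr0 addr0.
  have := archi_boundP (_ : 0 <= (z - x0) / C).
  rewrite divr_ge0 ?subr_ge0 ?(ltW C_gt0) // => /(_ isT).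
  by rewrite ltr_pdivrMr // mulr_natl; lra.
have [y_gt0 py yk /(_ ((z - y) / phi y))] :=
  HX y ltac:(rewrite /x0 in x0y; lra).
rewrite divr_ge0 ?subr_ge0 ?(ltW py) //= ler_pdivrMr // mul1r lerBlDl (ltW zy).
move=> /(_ isT)/andP[_]; rewrite divfK ?gt_eqF // subrKC.
have -> : (1 + rho * ((z - y) / phi y) + e1) * phi y =
    phi y + rho * (z - y) + e1 * phi y by field; rewrite gt_eqF.
have : e1 * phi y <= e / 4 * z.
  apply: (@le_trans _ _ (e1 * k * y)); first by rewrite -mulrA ler_pM2l.
  by rewrite ler_pM // ?mulr_ge0 // ltW.
have : e1 * (y - x0) <= e / 4 * z.
  by apply: ler_pM; rewrite ?subr_ge0 // ltW //; lra.
have : 0 <= rho * x0 by rewrite mulr_ge0 // ltW.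
move: z_C; rewrite ler_pdivrMr //; lra.
Unshelve. all: by end_near.
Qed.


(** * Increments along forward steps *)

Lemma one_sided_near (R : realType) (phi h : R -> R) (e : R) :
  one_sided_at phi h 0 -> 0 < e ->
  exists2 d, 0 < d & \forall x \near +oo, forall s, 0 <= s < d ->
    increment phi h s x < e.
Proof.
move=> os e0; have K0 : Klim phi h 0 = 0.
  rewrite /Klim; apply/cvg_lim => //.
  rewrite (_ : increment phi h 0 = cst 0); first exact: cvg_cst.
  by apply/funext => x; rewrite /increment mul0r addr0 subrr.
have nbhs_e : nbhs (0 : \bar R) [set y | (y < e%:E)%E].
  apply: open_nbhs_nbhs; split; last by rewrite /= lte_fin.
  exact: open_ereal_lt_ereal.
move: os; rewrite /one_sided_at K0 => /(_ _ nbhs_e)[r /= r0] /(_ (r / 2)) /=.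
rewrite sub0r normrN gtr0_norm ?divr_gt0 // => /(_ ltac:(lra) ltac:(lra)).
rewrite limf_esupE => /ereal_inf_lt[_ [V Voo <-] Vlt].
exists (r / 2); first lra.
apply: filterS Voo => x Vx s /andP[s0 sr]; rewrite -lte_fin.
apply: le_lt_trans Vlt; apply: (@le_trans _ _ (ereal_sup
  [set (increment phi h s0 x)%:E | s0 in [set s1 | 0 <= s1 < 0 + r / 2]])).
  by apply: ereal_sup_ubound; exists s => //=; rewrite s0 add0r.
by apply: ereal_sup_ubound; exists x.
Qed.

Lemma increment_cocycle (R : realType) (phi h : R -> R) (t t' x : R) :
  phi (x + t * phi x) != 0 ->
  increment phi h t' x = increment phi h t x +
    increment phi h ((t' - t) * phi x / phi (x + t * phi x)) (x + t * phi x).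
Proof.
move=> phi0; rewrite /increment divfK //.
have -> : x + t * phi x + (t' - t) * phi x = x + t' * phi x by ring.
ring.
Qed.

Section Beurling.
Variables (R : realType) (phi eta h : R -> R) (rho : R).
Hypothesis phi_SE : self_equivarying phi eta.
Hypothesis rho_ge0 : 0 <= rho.
Hypothesis eta_rho : forall t, 0 <= t -> eta t = 1 + rho * t.
Hypothesis phi_SN : rho = 0 -> phi x / x @[x --> +oo] --> 0.

Lemma phi_gt0_near : \forall x \near +oo, 0 < phi x.
Proof.
have [phi_gt0 _ _ _] := phi_SE; apply: filterS phi_gt0 _.
exact/nbhs_pinfty_gt/num_real.
Qed.

Lemma phi_le_near e : 0 < e -> \forall x \near +oo, phi x <= (rho + e) * x.
Proof.
move: rho_ge0; rewrite le_eqVlt => /predU1P[rho0 e0|rho_gt0 e0]; last first.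
  exact: ratio_le phi_SE eta_rho rho_gt0 e0.
near=> x; have x0 : 0 < x by near: x; exact/nbhs_pinfty_gt/num_real.
rewrite -rho0 add0r -ler_pdivrMr //; apply/ltW/ltr_normlW.
rewrite -[X in `|X|]subr0 distrC; near: x.
exact: (cvgr_dist_lt _ _ (phi_SN (esym rho0)) _ e0).
Unshelve. all: by end_near.
Qed.

(** For a < 0 the bound on phi(x) / x gives x + a phi(x) >= (1 + rho a) / 2 * x,
    with e chosen so that 1 + a (rho + e) = (1 + rho a) / 2. *)
Lemma near_shift a (P : R -> Prop) : 0 < 1 + rho * a ->
  (\forall y \near +oo, P y) ->
  \forall x \near +oo, forall t, a <= t -> P (x + t * phi x).
Proof.
move=> a1 [M [_ HM]].
pose e := (1 + rho * a) / (2 * - a).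
near=> x => t at_; apply: HM.
have x0 : 0 < x by near: x; exact/nbhs_pinfty_gt/num_real.
have px : 0 < phi x by near: x; exact phi_gt0_near.
have Mx : M < x by near: x; exact/nbhs_pinfty_gt/num_real.
have phi_e : 0 < e -> phi x <= (rho + e) * x.
  near: x; have [e0|e0] := boolP (0 < e); last by near=> x.
  by near=> x => _; near: x; exact: phi_le_near.
apply: (@lt_le_trans _ _ (x + a * phi x)); last by rewrite lerD2l ler_pM2r.
have [a0|a0] := leP 0 a.
  by apply: (lt_le_trans Mx); rewrite lerDl mulr_ge0 // ltW.
have {}phi_e := phi_e ltac:(by rewrite divr_gt0 // mulr_gt0 ?oppr_gt0).
have : a * ((rho + e) * x) <= a * phi x by rewrite ler_nM2l.
have -> : a * ((rho + e) * x) = (1 + rho * a) / 2 * x - x.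
  by rewrite /e; field; rewrite lt_eqF.
have : M * 2 / (1 + rho * a) < x by near: x; exact/nbhs_pinfty_gt/num_real.
rewrite ltr_pdivrMr //; lra.
Unshelve. all: by end_near.
Qed.

(** * Cells of nearly constant increments *)

Hypothesis h_cvg : exists2 S : set R,
  comeagre_in (Gplus rho) S & S `<=` Aphi phi h rho.
Hypothesis h_one_sided : one_sided_at phi h 0.

Lemma itv_Gplus a b : 0 < 1 + rho * a -> [set` `]a, b[] `<=` Gplus rho.
Proof.
move=> a1 t; rewrite /= in_itv /= => /andP[at_ _]; apply/Gplus_gt0 => //.
by apply: lt_le_trans a1 _; rewrite lerD2l ler_wpM2l // ltW.
Qed.

Lemma cvg_increment_dense a b : a < b -> 0 < 1 + rho * a ->
  exists2 t, a < t < b & cvg (increment phi h t x @[x --> +oo]).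
Proof.
move=> ab a1; have [S SG SA] := h_cvg.
have [|_ [a' [b' [aa' ab' b'b]]]] :=
  comeagre_cover_dense SG ab (itv_Gplus a1) (E := fun=> S).
  by move=> t [St _]; exists 0.
move=> /(_ _ _ (lexx _) ab' (lexx _))[t /andP[at_ tb] /SA[_ ?]].
by exists t; rewrite // (le_lt_trans aa') // (lt_le_trans tb).
Qed.

(** The class of t is coded by a threshold m and by the integer part j of the
    limit divided by e / 2; the point t found between u and v may depend on x,
    but m and j do not. *)
Lemma baire_cell a b e : a < b -> 0 < 1 + rho * a -> 0 < e ->
  exists c a' b', [/\ a <= a', a' < b', b' <= b &
    \forall x \near +oo, forall u v, a' <= u -> u < v -> v <= b' ->
      exists2 t, u < t < v & `|increment phi h t x - c| < e].
Proof.
move=> ab a1 e0; have [S SG SA] := h_cvg.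
pose cell (mj : nat * int) := [set t | forall x, mj.1%:R < x ->
  `|increment phi h t x - mj.2%:~R * (e / 2)| < e].
pose E n := if unpickle n is Some mj then cell mj else set0.
have [|n [a' [b' [aa' ab' b'b dense_E]]]] :=
    comeagre_cover_dense SG ab (itv_Gplus a1) (E := E).
  move=> t [/SA[_ /cvg_ex[/= k inc_t]] _].
  have e2 : 0 < e / 2 by rewrite divr_gt0.
  have [M [_ HM]] := cvgr_dist_lt _ _ inc_t _ e2.
  pose j := Num.floor (k / (e / 2)); pose m := Num.bound `|M|.
  exists (pickle (m, j)) => //; rewrite /E pickleK => x /= mx.
  have := HM x (lt_trans (le_lt_trans (ler_norm M) (archi_boundP _)) mx).
  move=> /(_ (normr_ge0 _)) /[!ltr_distl] /andP[klo khi].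
  have /andP[] := floor_itv (k / (e / 2)); rewrite -/j intrD.
  rewrite ler_pdivlMr // ltr_pdivrMr // mulrDl => jk kj.
  by apply/andP; split; lra.
move: dense_E; rewrite /E.
case: unpickle => [[m j] dense_E|dense_E]; last first.
  by have [] := dense_E a' b' (lexx _) ab' (lexx _).
exists (j%:~R * (e / 2)), a', b'; split => //.
near=> x => u v au uv vb; have [t utv Ht] := dense_E u v au uv vb.
by exists t => //; apply: Ht => /=; near: x; exact/nbhs_pinfty_gt/num_real.
Unshelve. all: by end_near.
Qed.

(** If t' is in the dense class and slightly larger than t, then h rises little
    from x + t phi(x) to x + t' phi(x), which bounds the increment at t from
    below; a t' slightly smaller than t bounds it from above. The length of this
    second step, measured in units of phi at x + t' phi(x), is small only if phi
    there is not much smaller than phi(x). Working at t >= 0 ensures this, since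
    the ratio of the two exceeds 1/2. *)
Lemma forward_cell e : 0 < e -> exists c a b, [/\ 0 <= a, a < b &
  \forall x \near +oo, forall t, a < t < b -> `|increment phi h t x - c| < e].
Proof.
move=> e0; have e2 : 0 < e / 2 by rewrite divr_gt0.
have one0 : 0 < 1 + rho * 0 by rewrite mulr0 addr0.
have [c [a [b [a0 ab b1 dense_ab]]]] := baire_cell ltr01 one0 e2.
have [d d0 rise] := one_sided_near h_one_sided e2.
exists c, a, b; split => //; near=> x => t /andP[at_ tb].
have px : 0 < phi x by near: x; exact phi_gt0_near.
have half s : 0 <= s <= 1 -> phi x < 2 * phi (x + s * phi x).
  have : forall s, 0 <= s <= 1 ->
      `|phi (x + s * phi x) / phi x - (1 + rho * s)| < 2^-1.
    by near: x; apply: (equivarying_near _ phi_SE eta_rho); rewrite invr_gt0.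
  move=> /(_ s) + /andP[s0 s1]; rewrite s0 s1 => /(_ isT).
  rewrite ltr_distl => /andP[+ _]; rewrite ltr_pdivlMr //.
  have : 0 <= rho * s * phi x by rewrite !mulr_ge0 // ltW.
  lra.
have upper s s' : a <= s -> s < b -> s <= s' -> s' - s < d / 2 ->
    increment phi h s' x < increment phi h s x + e / 2.
  move=> as_ sb ss' s'd; have /half ps : 0 <= s <= 1 by lra.
  have py : 0 < phi (x + s * phi x) by lra.
  rewrite (@increment_cocycle _ _ _ s s') ?gt_eqF // ltrD2l.
  have : forall s, 0 <= s -> forall r, 0 <= r < d ->
      increment phi h r (x + s * phi x) < e / 2.
    by near: x; exact: (near_shift one0 rise).
  apply; first lra.
  rewrite divr_ge0 ?mulr_ge0 ?subr_ge0 ?(ltW px) ?(ltW py) //=.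
  rewrite ltr_pdivrMr //; apply: (@lt_trans _ _ (d / 2 * phi x)).
    by rewrite ltr_pM2r.
  by rewrite -mulrA ltr_pM2l //; lra.
have dense_x : forall u v, a <= u -> u < v -> v <= b ->
  exists2 t, u < t < v & `|increment phi h t x - c| < e / 2 by near: x.
rewrite ltr_distl; apply/andP; split.
  have [||| s /andP[ts]] := dense_x t (Num.min b (t + d / 2)).
  - exact: ltW.
  - by rewrite lt_min tb; lra.
  - by rewrite ge_min lexx.
  rewrite lt_min ltr_distl => /andP[_ sd] /andP[slo _].
  by have := upper t s (ltW at_) tb (ltW ts) ltac:(lra); lra.
have [||| s /andP[+ st]] := dense_x (Num.max a (t - d / 2)) t.
- by rewrite le_max lexx.
- by rewrite gt_max at_; lra.
- exact: ltW.
rewrite gt_max ltr_distl => /andP[as_ sd] /andP[_ shi].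
by have := upper s t (ltW as_) (lt_trans st tb) (ltW st) ltac:(lra); lra.
Unshelve. all: by end_near.
Qed.

(** With m the centre of a forward cell and y = x + s phi(x), the step of size m
    from y lands at x + t phi(x), where t = s + m phi(y) / phi(x) is close to m
    and thus in the cell. The increments of size t from x and of size m from y
    are both close to c, and their difference is the increment of size s. *)
Lemma small_increment e : 0 < e -> exists2 d, 0 < d &
  \forall x \near +oo, forall s, 0 <= s < d -> `|increment phi h s x| < e.
Proof.
move=> e0; have e2 : 0 < e / 2 by rewrite divr_gt0.
have [c [a [b [a0 ab cell]]]] := forward_cell e2.
pose m := (a + b) / 2; pose r := (b - a) / 2.
have m0 : 0 < m by rewrite /m; lra.
have r0 : 0 < r by rewrite /r; lra.
have mr : 0 < 1 + m * rho by rewrite ltr_pwDl // mulr_ge0 // ltW.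
have d0 : 0 < r / 2 / (1 + m * rho) by rewrite divr_gt0 // divr_gt0.
exists (Num.min 1 (r / 2 / (1 + m * rho))); first by rewrite lt_min ltr01.
have one0 : 0 < 1 + rho * 0 by rewrite mulr0 addr0.
near=> x => s /andP[s0]; rewrite lt_min ltr_pdivlMr // => /andP[s1 sr].
have px : 0 < phi x by near: x; exact phi_gt0_near.
have py : 0 < phi (x + s * phi x).
  have : forall s, 0 <= s -> 0 < phi (x + s * phi x).
    by near: x; exact: (near_shift one0 phi_gt0_near).
  exact.
pose q := phi (x + s * phi x) / phi x.
have q_near : `|q - (1 + rho * s)| < r / 2 / m.
  have : forall s, 0 <= s <= 1 ->
      `|phi (x + s * phi x) / phi x - (1 + rho * s)| < r / 2 / m.
    by near: x; apply: (equivarying_near _ phi_SE eta_rho);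
      rewrite divr_gt0 // divr_gt0.
  by apply; lra.
have : a < s + m * q < b.
  have mw : m * (r / 2 / m) = r / 2 by rewrite mulrC divfK // gt_eqF.
  move: q_near; rewrite ltr_distl -(ltr_pM2l m0) -[X in _ && X](ltr_pM2l m0).
  rewrite mulrBr mulrDr mw => /andP[? ?].
  have : 0 <= m * (rho * s) by rewrite (mulr_ge0 (ltW m0)) ?mulr_ge0.
  have [mE rE] : m = (a + b) / 2 /\ r = (b - a) / 2 by [].
  move=> ?; apply/andP; split; lra.
have cell_x : forall t, a < t < b -> `|increment phi h t x - c| < e / 2.
  by near: x.
move=> /cell_x.
rewrite (@increment_cocycle _ _ _ s (s + m * q)) ?gt_eqF //.
have -> : (s + m * q - s) * phi x / phi (x + s * phi x) = m.
  by rewrite /q; field; rewrite !gt_eqF.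
have : `|increment phi h m (x + s * phi x) - c| < e / 2.
  have : forall s, 0 <= s -> forall t, a < t < b ->
      `|increment phi h t (x + s * phi x) - c| < e / 2.
    by near: x; exact: (near_shift one0 cell).
  by apply => //; rewrite /m; apply/andP; split; lra.
rewrite [X in _ -> _ -> is_true X]ltr_norml !ltr_distl => /andP[? ?] /andP[? ?].
by apply/andP; split; lra.
Unshelve. all: by end_near.
Qed.

(** As short forward increments are now bounded on both sides, comparison with
    the dense class to the right of t suffices. The distance allowed is
    d phi(y) / phi(x), with y = x + t phi(x); it may be arbitrarily small when
    t < 0, but this is harmless: a point of the class may be picked as close to
    t as the given x requires, at no cost in the threshold for x. *)
Lemma uniform_cell a b e : a < b -> 0 < 1 + rho * a -> 0 < e ->
  exists c a' b', [/\ a <= a', a' < b', b' <= b &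
    \forall x \near +oo, forall t, a' < t < b' ->
      `|increment phi h t x - c| < e].
Proof.
move=> ab a1 e0; have e2 : 0 < e / 2 by rewrite divr_gt0.
have [c [a' [b' [aa' ab' b'b dense_ab]]]] := baire_cell ab a1 e2.
have [d d0 small] := small_increment e2.
exists c, a', b'; split => //; near=> x => t /andP[at_ tb].
have px : 0 < phi x by near: x; exact phi_gt0_near.
have py : 0 < phi (x + t * phi x).
  have : forall s, a <= s -> 0 < phi (x + s * phi x).
    by near: x; exact: (near_shift a1 phi_gt0_near).
  by apply; lra.
have dense_x : forall u v, a' <= u -> u < v -> v <= b' ->
  exists2 t, u < t < v & `|increment phi h t x - c| < e / 2 by near: x.
pose q := phi (x + t * phi x) / phi x.
have q0 : 0 < q by rewrite divr_gt0.
have [||| s /andP[ts]] := dense_x t (Num.min b' (t + d * q)).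
- exact: ltW.
- by rewrite lt_min tb ltrDl mulr_gt0.
- by rewrite ge_min lexx.
rewrite lt_min -ltrBlDl => /andP[_ sd].
rewrite (@increment_cocycle _ _ _ t s) ?gt_eqF //.
have : `|increment phi h ((s - t) * phi x / phi (x + t * phi x))
    (x + t * phi x)| < e / 2.
  have : forall s, a <= s -> forall r, 0 <= r < d ->
      `|increment phi h r (x + s * phi x)| < e / 2.
    by near: x; exact: (near_shift a1 small).
  apply; first lra.
  rewrite divr_ge0 ?mulr_ge0 ?subr_ge0 ?(ltW ts) ?(ltW px) ?(ltW py) //=.
  by rewrite ltr_pdivrMr // -ltr_pdivlMr // -mulrA.
rewrite [X in is_true X -> _]ltr_norml !ltr_distl => /andP[? ?] /andP[? ?].
by apply/andP; split; lra.
Unshelve. all: by end_near.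
Qed.

(** Popa composition: a step s followed by a step u amounts to
    s + u (1 + rho s) in the limit. The cell ]a, b[ lies to the left of t0, and
    s > 0 is chosen, among the dense set of steps along which the increments
    converge, so that u = (t0 - s) / (1 + rho s) falls inside the cell. *)
Lemma locally_uniform t0 e : 0 < 1 + rho * t0 -> 0 < e ->
  exists c d, 0 < d /\ \forall x \near +oo, forall t, t0 - d < t < t0 + d ->
    `|increment phi h t x - c| < e.
Proof.
move=> t1 e0; have e2 : 0 < e / 2 by rewrite divr_gt0.
have rho1 : 0 < 1 + rho by rewrite ltr_pwDl.
(* a point of the half-line to the left of t0: 1 + rho a0 is
   (1 + rho t0) / (1 + rho) *)
pose a0 := t0 - (1 + rho * t0) / (1 + rho).
have a0_lt : a0 < t0 by rewrite /a0 ltrBlDr ltrDl divr_gt0.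
have a0_gt : 0 < 1 + rho * a0.
  have -> : 1 + rho * a0 = (1 + rho * t0) / (1 + rho).
    by rewrite /a0; field; rewrite gt_eqF.
  exact: divr_gt0.
have [c [a [b [a0a ab bt cell]]]] := uniform_cell a0_lt a0_gt e2.
have a1 : 0 < 1 + rho * a.
  by apply: lt_le_trans a0_gt _; rewrite lerD2l ler_wpM2l.
have b1 : 0 < 1 + rho * b.
  by apply: lt_le_trans a1 _; rewrite lerD2l ler_wpM2l // ltW.
have [||s /andP[]] := @cvg_increment_dense
  ((t0 - b) / (1 + rho * b)) ((t0 - a) / (1 + rho * a)).
- rewrite ltr_pdivrMr // mulrAC ltr_pdivlMr // -subr_gt0.
  have -> : (t0 - a) * (1 + rho * b) - (t0 - b) * (1 + rho * a) =
    (b - a) * (1 + rho * t0) by ring.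
  by rewrite mulr_gt0 // subr_gt0.
- by rewrite ltr_pwDl // mulr_ge0 // divr_ge0 ?subr_ge0 // ltW.
move=> bs sa /cvg_ex[/= k inc_s].
have s0 : 0 <= s.
  by apply: le_trans (ltW bs); rewrite divr_ge0 ?subr_ge0 // ltW.
rewrite ltr_pdivrMr // in bs; rewrite ltr_pdivlMr // in sa.
(* room left in the cell, seen from x in units of phi(x); half of it absorbs
   the variation of t, half the error on phi(y) / phi(x) *)
pose mu := Num.min (t0 - s - a * (1 + rho * s)) (b * (1 + rho * s) - (t0 - s)).
have mu0 : 0 < mu by rewrite lt_min; apply/andP; split; lra.
have mua : mu <= t0 - s - a * (1 + rho * s) by rewrite ge_min lexx.
have mub : mu <= b * (1 + rho * s) - (t0 - s) by rewrite ge_min lexx orbT.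
pose w := mu / 2 / (`|a| + `|b| + 1).
have ab1 : 0 < `|a| + `|b| + 1 by rewrite ltr_wpDl // addr_ge0.
have w0 : 0 < w by rewrite !divr_gt0.
have wa (z : R) : `|z| <= `|a| + `|b| + 1 -> `|z| * w <= mu / 2.
  move=> zle; apply: le_trans (_ : (`|a| + `|b| + 1) * w <= _).
    by rewrite ler_pM2r.
  by rewrite mulrC divfK // gt_eqF.
have s1 : 0 < 1 + rho * s by rewrite ltr_pwDl // mulr_ge0.
exists (k + c), (mu / 2); split; first by rewrite divr_gt0.
near=> x => t /andP[t_lo t_hi].
have px : 0 < phi x by near: x; exact phi_gt0_near.
have py : 0 < phi (x + s * phi x).
  have : forall r, s <= r -> 0 < phi (x + r * phi x).
    by near: x; exact: (near_shift s1 phi_gt0_near).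
  exact.
pose q := phi (x + s * phi x) / phi x.
have q0 : 0 < q by rewrite divr_gt0.
have q_near : `|q - (1 + rho * s)| < w.
  have : forall r, 0 <= r <= s ->
      `|phi (x + r * phi x) / phi x - (1 + rho * r)| < w.
    by near: x; exact: (equivarying_near _ phi_SE eta_rho).
  by apply; rewrite s0 lexx.
have q_mul (z : R) : `|z| <= `|a| + `|b| + 1 ->
    `|z * q - z * (1 + rho * s)| <= mu / 2.
  move=> zle; rewrite -mulrBr normrM (le_trans _ (wa z zle)) //.
  by rewrite ler_wpM2l // ltW.
have in_cell : a < (t - s) / q < b.
  have /q_mul : `|a| <= `|a| + `|b| + 1 by rewrite -addrA lerDl addr_ge0.
  have /q_mul : `|b| <= `|a| + `|b| + 1.
    by rewrite addrAC lerDr addr_ge0.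
  rewrite !ler_distl ltr_pdivlMr // ltr_pdivrMr // => /andP[? ?] /andP[? ?].
  by apply/andP; split; lra.
rewrite (@increment_cocycle _ _ _ s t) ?gt_eqF //.
have -> : (t - s) * phi x / phi (x + s * phi x) = (t - s) / q.
  by rewrite /q; field; rewrite !gt_eqF.
have : `|increment phi h ((t - s) / q) (x + s * phi x) - c| < e / 2.
  have : forall r, s <= r -> forall t, a < t < b ->
      `|increment phi h t (x + r * phi x) - c| < e / 2.
    by near: x; exact: (near_shift s1 cell).
  exact.
have : `|k - increment phi h s x| < e / 2.
  by near: x; exact: cvgr_dist_lt inc_s _ e2.
rewrite !ltr_distl => /andP[? ?] /andP[? ?].
by apply/andP; split; lra.
Unshelve. all: by end_near.
Qed.

End Beurling.

Unset Implicit Arguments.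
Set Strict Implicit.

Theorem theorem4 (R : realType) (phi eta h : R -> R) (rho : R)
    (phi_SE : self_equivarying phi eta)
    (rho_ge0 : 0 <= rho)
    (eta_rho : forall t, 0 <= t -> eta t = 1 + rho * t)
    (phi_SN : rho = 0 -> phi x / x @[x --> +oo] --> 0)
    (h_cvg : exists2 S : set R,
       comeagre_in (Gplus rho) S & S `<=` Aphi phi h rho)
    (K_usc : exists2 S : set R,
       comeagre_in (Gplus rho) S &
       usc_on (S `&` Aphi phi h rho) (Klim phi h))
    (h_one_sided : one_sided_at phi h 0) :
  Aphi phi h rho = Au phi h rho /\ Au phi h rho = Gplus rho.
Proof.
have G_Au : Gplus rho `<=` Au phi h rho.
  move=> t0 Gt0; have t1 := (Gplus_gt0 t0 rho_ge0).1 Gt0.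
  have unif := locally_uniform phi_SE rho_ge0 eta_rho phi_SN h_cvg
    h_one_sided t1.
  have cvg_t0 : cvg (increment phi h t0 x @[x --> +oo]).
    apply/cauchy_cvgP/cauchy_exP => e /= e0.
    have [c [d [d0 near_c]]] := unif _ e0.
    exists c; apply: filterS near_c => x; rewrite /ball /= distrC; apply.
    by apply/andP; split; lra.
  split; first by split.
  move=> e e0; have e2 : 0 < e / 2 by rewrite divr_gt0.
  have [c [d [d0 near_c]]] := unif _ e2.
  have Kc : `|Klim phi h t0 - c| <= e / 2.
    rewrite ler_distl; apply/andP; split.
      apply: limr_ge => //; apply: filterS near_c => x /(_ t0).
      by rewrite ltr_distl => /(_ ltac:(lra)); lra.
    apply: limr_le => //; apply: filterS near_c => x /(_ t0).
    by rewrite ltr_distl => /(_ ltac:(lra)); lra.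
  have [X [_ HX]] := near_c; exists d, X; split => // x s Xx /(HX x Xx).
  move: Kc; rewrite ler_distl !ltr_distl => /andP[? ?] /andP[? ?].
  by apply/andP; split; lra.
have Au_A : Au phi h rho `<=` Aphi phi h rho by move=> t [].
have A_G : Aphi phi h rho `<=` Gplus rho by move=> t [].
split; apply/seteqP; split=> //.
  by move=> t /A_G/G_Au.
by move=> t /Au_A/A_G.
Qed.
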